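(* Let $n\ge 2$, let $x_1,\dots,x_n\in\mathcal{D}\subseteq\mathbb{R}^d$, and let $\mu(x_1),\dots,\mu(x_n)$ be observed measures in $\mathcal{P}_2(\mathbb{R})$. Assume that the associated observed quantile functions $Q_{\mu(x_1)},\dots,Q_{\mu(x_n)}$ are realizations, at $x_1,\dots,x_n$, of an isotropic and stationary $\mathcal{Q}$-valued spatially correlated stochastic process $\{\mathbf{Q}_{\mu(x)},x\in\mathcal{D}\}$ with semivariogram $\gamma^{W}$. Let $\Gamma_{W}$ be the $n\times n$ matrix with entries $(\Gamma_{W})_{i,j}=\gamma^{W}(\|x_i-x_j\|)$, assume that $\Gamma_W$ is invertible and $\mathbb{1}_n^\top\Gamma_W^{-1}\mathbb{1}_n\neq 0$, and set $$\tilde{\Gamma}=\Gamma_{W}^{-1}-\Gamma_{W}^{-1}\mathbb{1}_n(\mathbb{1}_n^\top\Gamma_{W}^{-1}\mathbb{1}_n)^{-1}\mathbb{1}_n^\top\Gamma_{W}^{-1}.$$ Assume $\tilde\Gamma_{i,i}\neq 0$ for all $i$. Then for every $i\in\{1,\dots,n\}$, the leave-one-out ordinary Kriging prediction $\hat{Q}^{(-i)}_{\mu(x_i)}$ of $Q_{\mu(x_i)}$ satisfies $$Q_{\mu(x_i)}-\hat{Q}^{(-i)}_{\mu(x_i)}=\sum_{j=1}^{n}\frac{\tilde{\Gamma}_{i,j}}{\tilde{\Gamma}_{i,i}}\,Q_{\mu(x_j)}$$ as functions on $(0,1)$.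
   Context: $\mathcal{P}_2(\mathbb{R})$ is the set of probability measures on $\mathbb{R}$ with finite second moment. For $\mu\in\mathcal{P}_2(\mathbb{R})$ the quantile function is $Q_\mu:(0,1)\to\mathbb{R}$, $Q_\mu(\xi)=\inf\{x\in\mathbb{R}:\mu((-\infty,x])\ge\xi\}$, and $\mathcal{Q}\subset L_2([0,1])$ is the space of quantile functions. $\mathbb{1}_m$ is the column vector of ones of size $m$, and $\|\cdot\|$ is a norm (classically Euclidean) on $\mathbb{R}^d$. Semivariogram: for a $\mathcal{Q}$-valued process $\{\mathbf{Q}_{\mu(x)},x\in\mathcal{D}\}$ (with finite second moments $\mathbb{E}\int_0^1\mathbf{Q}_{\mu(x)}(\xi)^2d\xi<\infty$), $$\gamma^{W}(x,x')=\tfrac12\mathbb{E}\Big[\int_0^1(\mathbf{Q}_{\mu(x)}(\xi)-\mathbf{Q}_{\mu(x')}(\xi))^2d\xi\Big].$$ When the process is isotropic and stationary this depends only on $h=\|x-x'\|$ and is written $\gamma^{W}(h)$; also $\mathbb{E}\int_0^1\mathbf{Q}_{\mu(x)}(\xi)^2d\xi$ does not depend on $x$. Ordinary Kriging: given observation points $z_1,\dots,z_m\in\mathcal{D}$ and a target point $x^\star\in\mathcal{D}$, the weights are $$\bar\lambda=\operatorname{argmin}\Big\{\mathbb{E}\Big[\int_0^1\Big(\mathbf{Q}_{\mu(x^\star)}(\xi)-\sum_{k=1}^m\lambda_k\mathbf{Q}_{\mu(z_k)}(\xi)\Big)^2d\xi\Big]:\ \lambda\in\mathbb{R}^m,\ \sum_{k=1}^m\lambda_k=1\Big\};$$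 equivalently, $\bar\lambda$ is the $\lambda$-component of the solution $(\lambda,\alpha)\in\mathbb{R}^m\times\mathbb{R}$ of $$\begin{bmatrix}G&\mathbb{1}_m\\ \mathbb{1}_m^\top&0\end{bmatrix}\begin{bmatrix}\lambda\\ \alpha\end{bmatrix}=\begin{bmatrix}g^\star\\ 1\end{bmatrix},\qquad G_{k,l}=\gamma^{W}(\|z_k-z_l\|),\quad g^\star_k=\gamma^{W}(\|z_k-x^\star\|).$$ The Kriging prediction of $Q_{\mu(x^\star)}$ from observed quantile functions is $\sum_{k=1}^m\bar\lambda_kQ_{\mu(z_k)}$. Leave-one-out prediction: $\hat{Q}^{(-i)}_{\mu(x_i)}$ is the Kriging prediction at the target point $x^\star=x_i$ computed from the $n-1$ observations $Q_{\mu(x_j)}$, $j\neq i$, at the points $x_j$, $j\ne i$, with the same semivariogram $\gamma^{W}$. *)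

(* Defs.v *)
From mathcomp Require Import all_boot all_order all_algebra.
From mathcomp Require Import all_classical all_reals all_analysis.

Set Implicit Arguments.
Unset Strict Implicit.
Unset Printing Implicit Defensive.

Import Order.TTheory GRing.Theory Num.Theory.

Local Open Scope classical_set_scope.
Local Open Scope ring_scope.

(** The library norm on ['rV[R]_d] is the sup norm; the distance on the spatial
    domain is allowed to come from any norm. *)
Definition is_norm (R : realType) (d : nat) (N : 'rV[R]_d -> R) : Prop :=
  [/\ forall x, 0 <= N x,
      forall x, N x = 0 -> x = 0,
      forall (a : R) x, N (a *: x) = `|a| * N x &
      forall x y, N (x + y) <= N x + N y].

Definition finite_second_moment (R : realType)
    (mu : probability (measurableTypeR R) R) : Prop :=
  (\int[mu]_x (x ^+ 2)%:E < +oo)%E.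

Definition quantile (R : realType) (mu : probability (measurableTypeR R) R)
    (xi : R) : R :=
  inf [set x : R | (xi%:E <= mu `]-oo, x]%classic)%E].

(** Quantile functions are functions on the open interval (0,1): the values of
    [q : R -> R] elsewhere are irrelevant. *)
Definition quantile_functions (R : realType) : set (R -> R) :=
  [set q | exists2 mu : probability (measurableTypeR R) R,
     finite_second_moment mu &
     forall xi, 0 < xi < 1 -> q xi = quantile mu xi].

Section Process.
Context (R : realType) (dT : measure_display) (T : measurableType dT).
Variable P : probability T R.

(** E [ \int_0^1 F(xi)^2 dxi ] for a random function F. *)
Definition mean_sq_L2 (F : T -> R -> R) : \bar R :=
  (\int[P]_w \int[lebesgue_measure]_(xi in `]0%R, 1%R[%classic)
     ((F w xi) ^+ 2)%:E)%E.

Variable d : nat.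

(** [Q x w] is the quantile function observed at the site [x] in the outcome
    [w]. Since quantile functions are left-continuous, measurability of all the
    evaluations at xi in (0,1) is the same as measurability of [w |-> Q x w] for
    the Borel sets of L_2([0,1]). *)
Definition quantile_process (D : set 'rV[R]_d) (Q : 'rV[R]_d -> T -> R -> R) :
    Prop :=
  forall x, D x ->
    [/\ forall w, quantile_functions (Q x w),
        forall xi : R, 0 < xi < 1 -> measurable_fun setT (fun w => Q x w xi) &
        (mean_sq_L2 (Q x) < +oo)%E].

Definition semivariogram (Q : 'rV[R]_d -> T -> R -> R) (x x' : 'rV[R]_d) :
    \bar R :=
  ((2^-1)%:E * mean_sq_L2 (fun w xi => Q x w xi - Q x' w xi)%R)%E.

(** Isotropy and stationarity in the second-order sense, [gamma] being the
    semivariogram as a function of the distance. *)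
Definition isotropic_stationary (D : set 'rV[R]_d) (N : 'rV[R]_d -> R)
    (Q : 'rV[R]_d -> T -> R -> R) (gamma : R -> R) : Prop :=
  (forall x x', D x -> D x' ->
     semivariogram Q x x' = (gamma (N (x - x')))%:E) /\
  (forall x x', D x -> D x' -> mean_sq_L2 (Q x) = mean_sq_L2 (Q x')).

Definition kriging_error (Q : 'rV[R]_d -> T -> R -> R) (m : nat)
    (z : 'I_m -> 'rV[R]_d) (xstar : 'rV[R]_d) (lam : 'cV[R]_m) : \bar R :=
  mean_sq_L2 (fun w xi => Q xstar w xi - \sum_(k < m) lam k 0 * Q (z k) w xi).

(** The set of minimizers; "lam is the argmin" reads
    [kriging_argmin Q z xstar = [set lam]]. *)
Definition kriging_argmin (Q : 'rV[R]_d -> T -> R -> R) (m : nat)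
    (z : 'I_m -> 'rV[R]_d) (xstar : 'rV[R]_d) : set 'cV[R]_m :=
  [set lam : 'cV[R]_m | \sum_(k < m) lam k 0 = 1 /\
     forall lam' : 'cV[R]_m, \sum_(k < m) lam' k 0 = 1 ->
       (kriging_error Q z xstar lam <= kriging_error Q z xstar lam')%E].

End Process.

Definition kriging_prediction (R : realType) (m : nat) (lam : 'cV[R]_m)
    (q : 'I_m -> R -> R) (xi : R) : R :=
  \sum_(k < m) lam k 0 * q k xi.

(** Leave-one-out data: [lift i] enumerates the indices different from [i]. *)
Definition leave_out (n : nat) (A : Type) (i : 'I_n) (f : 'I_n -> A) :
    'I_n.-1 -> A :=
  fun k => f (lift i k).

Definition semivariogram_matrix (R : realType) (d n : nat)
    (N : 'rV[R]_d -> R) (gamma : R -> R) (x : 'I_n -> 'rV[R]_d) : 'M[R]_n :=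
  \matrix_(i < n, j < n) gamma (N (x i - x j)).

Definition ones (R : realType) (n : nat) : 'cV[R]_n := const_mx 1.

Definition ones_form (R : realType) (n : nat) (G : 'M[R]_n) : R :=
  ((ones R n)^T *m invmx G *m ones R n) 0 0.

Definition Gamma_tilde (R : realType) (n : nat) (G : 'M[R]_n) : 'M[R]_n :=
  invmx G -
  (ones_form G)^-1 *: (invmx G *m ones R n *m (ones R n)^T *m invmx G).

(* Main.v *)
From HB Require Import structures.
Require Import Defs.
From mathcomp Require Import all_boot all_order all_algebra.
From mathcomp Require Import all_classical all_reals all_analysis.
From mathcomp Require Import measurable_realfun.
From mathcomp Require Import ring lra.

(** For weights [lam] summing to 1, let [c] be the
    coefficient vector of the residual Q(x_i) - sum_k lam_k Q(x_k): it has
    [c_i = 1] and total sum 0.  The mean square of a combination of the Q(x_j)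
    is [c^T B c], where [B] is the Gram matrix of the process in L_2 of the
    product of P and Lebesgue measure on (0,1) ([mean_sq_L2_comb]).  The
    semivariogram matrix is [Gamma_jk = (B_jj + B_kk) / 2 - B_jk], so on vectors
    of total sum 0 the two diagonal terms cancel and [c^T B c] is
    [- c^T Gamma c] ([quad_form_semivariogram]).  Hence leave-one-out Kriging
    maximizes the form [c^T Gamma c], which is nonpositive on the hyperplane
    [1^T c = 0], under the extra constraint [c_i = 1].

    The maximizer is the i-th column of [Gamma_tilde] divided by its diagonal
    entry.  Indeed [1^T Gamma_tilde = 0], and [h^T Gamma Gamma_tilde = h^T]
    whenever [1^T h = 0]; so if moreover [h_i = 0], then [h] is orthogonal for
    the form to that column, and Pythagoras applies ([quad_form_Pythagoras]).
    The maximizer is unique because the form is definite on the hyperplane: an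
    isotropic [h] of a semidefinite form lies in its radical, and testing against
    [Gamma_tilde h] returns [h^T h = 0] ([quad_form_definite]).
    The columns of the symmetric matrix [Gamma_tilde] thus are the
    leave-one-out residuals, up to scaling.

    The analytic content is the use of Tonelli and of the integrability of
    products, which needs joint measurability of [(w, xi) |-> Q x w xi]
    although the process is only assumed measurable in [w] for each [xi].  It
    follows from the left-continuity of quantile functions, in the form of
    [quantile_gt_rat] ([measurable_on_cylinder]). *)

Set Implicit Arguments.
Unset Strict Implicit.
Unset Printing Implicit Defensive.

Import Order.TTheory GRing.Theory Num.Theory.
Import numFieldNormedType.Exports.

Local Open Scope classical_set_scope.
Local Open Scope ring_scope.

(** * Quadratic forms on an affine hyperplane *)

Definition quad_form (R : comPzRingType) (n : nat) (M : 'M[R]_n) (c : 'cV[R]_n) : R :=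
  (c^T *m M *m c) 0 0.

Lemma quad_formE (R : comPzRingType) (n : nat) (M : 'M[R]_n) (c : 'cV[R]_n) :
  quad_form M c = \sum_(j < n) \sum_(k < n) c j 0 * c k 0 * M j k.
Proof.
rewrite /quad_form mxE exchange_big/=; apply: eq_bigr => k _.
rewrite mxE mulr_suml; apply: eq_bigr => j _.
by rewrite mxE mulrAC.
Qed.

Section ConstrainedMaximization.
Context (R : realType) (n : nat) (G : 'M[R]_n).
Hypothesis G_sym : G^T = G.
Hypothesis G_unit : G \in unitmx.
Hypothesis form_neq0 : ones_form G != 0.
Implicit Types (c h v : 'cV[R]_n).

Local Notation A := (Gamma_tilde G).
Local Notation u := (ones R n).

Lemma ones_trE c : (u^T *m c) = (\sum_(j < n) c j 0)%:M.
Proof.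
apply/matrixP => a b; rewrite !ord1 !mxE eqxx mulr1n.
by apply: eq_bigr => j _; rewrite !mxE mul1r.
Qed.

Lemma ones_tr_eq0 c : u^T *m c = 0 <-> \sum_(j < n) c j 0 = 0.
Proof.
rewrite ones_trE; split=> [/matrixP/(_ 0 0)|->]; last by rewrite raddf0.
by rewrite !mxE eqxx mulr1n.
Qed.

Lemma ones_form_scalar : u^T *m invmx G *m u = (ones_form G)%:M.
Proof. by rewrite -mx11_scalar. Qed.

Lemma Gamma_tilde_sym : A^T = A.
Proof.
have iGT : (invmx G)^T = invmx G by rewrite trmx_inv G_sym.
by rewrite /Gamma_tilde linearB/= linearZ/= !trmx_mul trmxK iGT !mulmxA.
Qed.

(** Together with [tr_mul_Gamma_tilde], this makes [Gamma_tilde] the inverse of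
    the form [G] restricted to the hyperplane of vectors of total sum 0. *)
Lemma ones_Gamma_tilde : u^T *m A = 0.
Proof.
rewrite /Gamma_tilde mulmxBr -scalemxAr !mulmxA ones_form_scalar.
by rewrite mul_scalar_mx -scalemxAl scalerA mulVf// scale1r subrr.
Qed.

Lemma tr_mul_Gamma_tilde h : u^T *m h = 0 -> h^T *m G *m A = h^T.
Proof.
move=> h0; have hu : h^T *m u = 0 by rewrite -[u]trmxK -trmx_mul h0 trmx0.
rewrite /Gamma_tilde mulmxBr -scalemxAr !mulmxA mulmxK//.
by rewrite hu !mul0mx scaler0 subr0.
Qed.

Lemma sym_bilinC c h : (c^T *m G *m h) 0 0 = (h^T *m G *m c) 0 0.
Proof.
have -> : (c^T *m G *m h) 0 0 = ((c^T *m G *m h)^T) 0 0 by rewrite [RHS]mxE.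
by rewrite !trmx_mul trmxK G_sym mulmxA.
Qed.

Lemma quad_formD c h :
  quad_form G (c + h) =
  quad_form G c + (h^T *m G *m c) 0 0 *+ 2 + quad_form G h.
Proof.
have mxD (X Y : 'M[R]_1) : (X + Y) 0 0 = X 0 0 + Y 0 0 by rewrite mxE.
rewrite /quad_form [(c + h)^T]linearD/= !mulmxDl !mulmxDr !mxD.
by rewrite (sym_bilinC c h); ring.
Qed.

Lemma quad_formZ (a : R) c : quad_form G (a *: c) = a ^+ 2 * quad_form G c.
Proof.
have mxZ (b : R) (X : 'M[R]_1) : (b *: X) 0 0 = b * X 0 0 by rewrite mxE.
by rewrite /quad_form [(a *: c)^T]linearZ/= -!scalemxAl -scalemxAr !mxZ mulrA.
Qed.

(** A null vector [h] of a semidefinite form is orthogonal to the whole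
    hyperplane, in particular to [v = A *m h]; but [h^T G v = h^T h].  The
    invertibility of [G] and [ones_form G != 0] enter through [A]. *)
Lemma quad_form_definite :
  (forall v, u^T *m v = 0 -> quad_form G v <= 0) ->
  forall h, u^T *m h = 0 -> quad_form G h = 0 -> h = 0.
Proof.
move=> Gle0 h uh qh.
set v := A *m h.
have uv : u^T *m v = 0 by rewrite /v mulmxA ones_Gamma_tilde mul0mx.
set s := \sum_(j < n) h j 0 ^+ 2.
have hGv : (h^T *m G *m v) 0 0 = s.
  rewrite /v mulmxA tr_mul_Gamma_tilde// mxE.
  by apply: eq_bigr => j _; rewrite mxE expr2.
have s_ge0 : 0 <= s by apply: sumr_ge0 => j _; exact: sqr_ge0.
suff s0 : s = 0.
  apply/colP => j; rewrite mxE; apply/eqP; rewrite -sqrf_eq0; apply/eqP.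
  apply: (psumr_eq0P _ s0) => // k _; exact: sqr_ge0.
apply/eqP; rewrite eq_le s_ge0 andbT leNgt; apply/negP => s_gt0.
set q := quad_form G v.
have q_le0 : q <= 0 by exact: Gle0.
(* A small step along [v] would make the form positive; this step solves
   [t * (1 - q) = s], which makes [2 * t * s + t ^ 2 * q = t * (s + t)]. *)
pose t := s / (1 - q).
have t_gt0 : 0 < t by rewrite divr_gt0//; lra.
have tq : t * q = t - s by rewrite /t; field; rewrite lt0r_neq0//; lra.
have := Gle0 (h + t *: v).
rewrite mulmxDr -scalemxAr uh uv scaler0 addr0 => /(_ erefl).
rewrite quad_formD qh quad_formZ -/q.
have -> : ((t *: v)^T *m G *m h) 0 0 = t * s.
  by rewrite [(t *: v)^T]linearZ/= -!scalemxAl mxE -hGv sym_bilinC.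
by rewrite expr2 -mulrA tq; nra.
Qed.

Definition residual_col (i : 'I_n) : 'cV[R]_n := (A i i)^-1 *: col i A.

Lemma residual_col_self i : A i i != 0 -> residual_col i i 0 = 1.
Proof. by move=> Aii; rewrite [LHS]mxE [col i A i 0]mxE mulVf. Qed.

Lemma ones_residual_col i : u^T *m residual_col i = 0.
Proof.
by rewrite -scalemxAr colE mulmxA ones_Gamma_tilde mul0mx scaler0.
Qed.

(** The difference [h = c - residual_col i] has total sum 0 and vanishes at [i],
    so that the cross term, a multiple of [h^T G A e_i = h^T e_i], is zero. *)
Lemma quad_form_Pythagoras (i : 'I_n) c :
  A i i != 0 -> u^T *m c = 0 -> c i 0 = 1 ->
  quad_form G c =
  quad_form G (residual_col i) + quad_form G (c - residual_col i).
Proof.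
move=> Aii uc ci; set c0 := residual_col i.
have -> : quad_form G c = quad_form G (c0 + (c - c0)).
  by rewrite [c0 + _]addrC subrK.
rewrite (quad_formD c0 (c - c0)).
suff -> : ((c - c0)^T *m G *m c0) 0 0 = 0 by rewrite mul0rn addr0.
rewrite {2}/c0 -scalemxAr colE mulmxA tr_mul_Gamma_tilde; last first.
  by rewrite mulmxBr uc ones_residual_col subrr.
have ci0 : (c - c0) i 0 = 0.
  by rewrite mxE [X in _ + X]mxE ci residual_col_self// subrr.
by rewrite -colE mxE [col i _ 0 0]mxE [_^T 0 i]mxE ci0 mulr0.
Qed.

Section Maximum.
Hypothesis G_le0 : forall v, u^T *m v = 0 -> quad_form G v <= 0.
Variables (i : 'I_n) (c : 'cV[R]_n).
Hypotheses (Aii : A i i != 0) (uc : u^T *m c = 0) (ci : c i 0 = 1).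

Lemma residual_col_max : quad_form G c <= quad_form G (residual_col i).
Proof.
rewrite (quad_form_Pythagoras Aii uc ci) gerDl G_le0//.
by rewrite mulmxBr uc ones_residual_col subrr.
Qed.

Lemma residual_col_unique :
  quad_form G (residual_col i) <= quad_form G c -> c = residual_col i.
Proof.
rewrite (quad_form_Pythagoras Aii uc ci) lerDl => h_ge0.
have uh : u^T *m (c - residual_col i) = 0.
  by rewrite mulmxBr uc ones_residual_col subrr.
apply/eqP; rewrite -subr_eq0; apply/eqP.
apply: (quad_form_definite G_le0) => //.
by apply/eqP; rewrite eq_le G_le0.
Qed.

End Maximum.

End ConstrainedMaximization.

(** * Quantile functions *)

Section Quantile.
Context (R : realType) (mu : probability (measurableTypeR R) R).

Let idTR : measurableTypeR R -> R := idfun.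

#[local] HB.instance Definition _ :=
  @isMeasurableFun.Build _ _ _ _ idTR (@measurable_id _ _ setT).

(** The distribution function of [mu] is the [cdf] of the identity. *)
Let idRV : {RV mu >-> R} := idTR.

Lemma quantile_set_neq0 (xi : R) :
  xi < 1 -> [set x : R | (xi%:E <= mu `]-oo, x]%classic)%E] !=set0.
Proof.
move=> xi1; apply/set0P/negP => /eqP S0.
suff : (1 <= xi%:E)%E by rewrite lee_fin leNgt xi1.
apply: (cvge_to_le (cvg_cdfy1 idRV)).
near=> r; rewrite leNgt; apply/negP => /ltW xir.
have : [set x : R | (xi%:E <= mu `]-oo, x]%classic)%E] r by [].
by rewrite S0.
Unshelve. all: by end_near. Qed.

Lemma quantile_set_lbound (xi : R) :
  0 < xi -> has_lbound [set x : R | (xi%:E <= mu `]-oo, x]%classic)%E].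
Proof.
move=> xi0; apply: contrapT => nlb.
suff : (xi%:E <= 0)%E by rewrite lee_fin leNgt xi0.
apply: (cvge_to_ge (cvg_cdfNy0 idRV)).
near=> r; rewrite leNgt; apply/negP => rxi; apply: nlb.
exists r => y /= xiy; rewrite leNgt; apply/negP => yr.
have : (cdf idRV y <= cdf idRV r)%E by apply: cdf_nondecreasing; exact: ltW.
by move=> /(le_trans xiy); rewrite leNgt rxi.
Unshelve. all: by end_near. Qed.

Lemma quantile_nondecreasing (xi xi' : R) :
  0 < xi -> xi <= xi' -> xi' < 1 -> quantile mu xi <= quantile mu xi'.
Proof.
move=> xi0 le_xi xi1; apply: lb_le_inf; first exact: quantile_set_neq0.
move=> y /= xiy; apply: ge_inf; first exact: quantile_set_lbound.
by apply: le_trans xiy; rewrite lee_fin.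
Qed.

(** Left-continuity of the quantile function, in the rational form that lets the
    set [a < quantile mu xi] be written as a countable union. *)
Lemma quantile_gt_rat (a xi : R) : 0 < xi < 1 -> a < quantile mu xi ->
  exists r : rat, [/\ 0 < ratr r :> R, ratr r <= xi & a < quantile mu (ratr r)].
Proof.
move=> /andP[xi0 xi1] a_lt; apply: contrapT => nex.
(* For [a < b < quantile mu xi], the distribution function at [b] is below [xi];
   any [r] between the two has its quantile at least [b]. *)
have [b /itvP ab] : exists b : rat, ratr b \in `]a, quantile mu xi[.
  exact: rat_in_itvoo.
have : quantile mu xi <= ratr b; last by rewrite leNgt ab.
apply: ge_inf; first exact: quantile_set_lbound.
rewrite /= leNgt; apply/negP => Fb.
have Ffin : mu `]-oo, (ratr b : R)]%classic \is a fin_num.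
  exact: fin_num_measure.
rewrite -(fineK Ffin) lte_fin in Fb.
have [r] : exists r : rat, ratr r \in
    `]Num.max 0 (fine (mu `]-oo, (ratr b : R)]%classic)), xi[.
  by apply: rat_in_itvoo; rewrite gt_max xi0.
rewrite in_itv/= gt_max => /andP[/andP[r0 Fr] rxi].
apply: nex; exists r; split => //; first exact: ltW.
apply: (@lt_le_trans _ _ (ratr b)); first by rewrite ab.
apply: lb_le_inf; first by apply: quantile_set_neq0; apply: lt_trans xi1.
move=> y /= ry; rewrite leNgt; apply/negP => yb.
have : (cdf idRV y <= cdf idRV (ratr b))%E.
  by apply: cdf_nondecreasing; exact: ltW.
move=> /(le_trans ry); rewrite /cdf /distribution /pushforward/=.
rewrite (_ : idRV @^-1` _ = `]-oo, (ratr b : R)]%classic)//.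
by rewrite -(fineK Ffin) lee_fin leNgt Fr.
Qed.

End Quantile.

(** * The Gram matrix of a random family *)

Section ProductSpace.
Context (R : realType) (dT : measure_display) (T : measurableType dT).
Variable P : probability T R.
Implicit Types f g : T -> R -> R.

Local Notation leb := (@lebesgue_measure R).
Local Notation Pleb := (P \x leb)%E.
Local Notation prodT := (T * measurableTypeR R)%type.

Definition cylinder : set prodT := setT `*` `]0%R, 1%R[%classic.

Lemma measurable_cylinder : measurable cylinder.
Proof. exact: measurableX. Qed.

(** The extension by 0 outside (0,1), where the values of [f] are arbitrary; it
    turns [mean_sq_L2] into one integral over the full product space. *)
Definition on_cylinder f : prodT -> R := (fun z => f z.1 z.2) \_ cylinder.

Lemma on_cylinderE f z :
  on_cylinder f z = if 0 < z.2 < 1 then f z.1 z.2 else 0.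
Proof.
rewrite /on_cylinder patchE; congr (if _ then _ else _).
by apply/idP/idP; rewrite inE/= /cylinder/= in_itv/=; [case|].
Qed.

(** Measurability in [w] for each [xi] gives joint measurability, since quantile
    functions are nondecreasing and left-continuous in [xi]: the set where
    [f > a] is the union over rational [r] of the rectangles
    [{w | f w r > a} x [r, 1[]. *)
Lemma measurable_on_cylinder f :
  (forall w, quantile_functions (f w)) ->
  (forall xi, 0 < xi < 1 -> measurable_fun setT (f ^~ xi)) ->
  measurable_fun setT (on_cylinder f).
Proof.
move=> qf mf; apply/(measurable_restrictT _ measurable_cylinder).
move=> mD; apply: (measurability _ (RGenOInfty.measurableE R)) => //.
move=> /= _ [_ [a ->] <-]; rewrite preimage_itvoy.
pose F (r : rat) : set prodT := if 0 < (ratr r : R) < 1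
  then [set w | a < f w (ratr r)] `*` `[ratr r, 1[%classic else set0.
rewrite [X in measurable X](_ : _ = \bigcup_(r : rat) F r).
  apply: bigcupT_measurable_rat => r; rewrite /F; case: ifPn => // r01.
  apply: measurableX => //; rewrite -[X in measurable X]setTI -preimage_itvoy.
  exact: mf.
rewrite predeqE => -[w xi]; split => /=.
  move=> [[_]]; rewrite /= in_itv/= => xi01.
  have [mu _ fmu] := qf w; rewrite fmu// => /(quantile_gt_rat xi01)[r [r0 rxi ar]].
  have /andP[_ xi1] := xi01.
  have r01 : 0 < (ratr r : R) < 1 by rewrite r0 (le_lt_trans rxi).
  by exists r => //; rewrite /F r01; split; rewrite /= ?fmu// in_itv/= rxi.
move=> [r _]; rewrite /F; case: ifPn => // r01 [/=].
have /andP[r0 r1] := r01.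
have [mu _ fmu] := qf w; rewrite fmu// in_itv/= => ar /andP[rxi xi1].
have xi01 : 0 < xi < 1 by rewrite xi1 (lt_le_trans r0).
split; first by split=> //=; rewrite in_itv.
by rewrite fmu// (lt_le_trans ar)// quantile_nondecreasing.
Qed.

Lemma mean_sq_L2E f : measurable_fun setT (on_cylinder f) ->
  mean_sq_L2 P f = (\int[Pleb]_z ((on_cylinder f z) ^+ 2)%:E)%E.
Proof.
move=> mf; rewrite fubini_tonelli1//; last 2 first.
- by apply/measurable_EFinP; exact: measurable_funX.
- by move=> z; rewrite lee_fin sqr_ge0.
apply: eq_integral => w _; rewrite /fubini_F [LHS]integral_mkcond.
apply: eq_integral => xi _; rewrite patchE mem_setE in_itv/= on_cylinderE/=.
by case: ifP; rewrite // expr0n.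
Qed.

Section Gram.
Variables (n : nat) (f : 'I_n -> T -> R -> R).
Hypothesis mf : forall j, measurable_fun setT (on_cylinder (f j)).
Hypothesis f_fin : forall j, (mean_sq_L2 P (f j) < +oo)%E.

Let prod_integrand j k z := on_cylinder (f j) z * on_cylinder (f k) z.

Definition gram : 'M[R]_n :=
  \matrix_(j, k) (\int[Pleb]_z (prod_integrand j k z)).

Lemma gram_sym : gram^T = gram.
Proof.
apply/matrixP => j k; rewrite !mxE; apply: eq_Rintegral => z _.
by rewrite /prod_integrand mulrC.
Qed.

(** [|s * t| <= s ^ 2 + t ^ 2]. *)
Lemma integrable_prod_integrand j k :
  Pleb.-integrable setT (EFin \o prod_integrand j k).
Proof.
have sq_int l : Pleb.-integrable setT
    (fun z => ((on_cylinder (f l) z) ^+ 2)%:E).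
  apply/integrableP; split.
    by apply/measurable_EFinP; exact: measurable_funX.
  under eq_integral => z _ do rewrite gee0_abs ?lee_fin ?sqr_ge0//.
  by rewrite -mean_sq_L2E.
apply: (@le_integrable _ _ _ _ _ measurableT _
  (fun z => ((on_cylinder (f j) z) ^+ 2)%:E + ((on_cylinder (f k) z) ^+ 2)%:E)%E).
- by apply/measurable_EFinP; exact: measurable_funM.
- move=> z _ /=; rewrite lee_fin [leRHS]ger0_norm ?addr_ge0 ?sqr_ge0//.
  rewrite /prod_integrand ler_norml; apply/andP.
  move: (on_cylinder _ z) (on_cylinder _ z) => s t.
  by split; nra.
- exact: integrableD.
Qed.

Lemma mean_sq_L2_comb (c : 'cV[R]_n) :
  mean_sq_L2 P (fun w xi => \sum_(j < n) c j 0 * f j w xi) =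
  (quad_form gram c)%:E.
Proof.
have combE z : on_cylinder (fun w xi => \sum_(j < n) c j 0 * f j w xi) z =
    \sum_(j < n) c j 0 * on_cylinder (f j) z.
  rewrite on_cylinderE; case: ifP => z01.
    by apply: eq_bigr => j _; rewrite on_cylinderE z01.
  by rewrite big1// => j _; rewrite on_cylinderE z01 mulr0.
rewrite mean_sq_L2E; last first.
  rewrite (funext combE); apply: measurable_sum => j.
  by apply: measurable_funM => //; exact: mf.
under eq_integral => z _.
  rewrite combE expr2 mulr_suml.
  under eq_bigr => j _ do rewrite mulr_sumr.
  rewrite pair_big/= -sumEFin.
  under eq_bigr => p _ do rewrite mulrACA EFinM.
  over.
rewrite integral_sum//; last first.
  move=> p; apply: integrableZl => //.
  exact: integrable_prod_integrand.
rewrite quad_formE pair_big/= -sumEFin; apply: eq_bigr => p _.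
rewrite integralZl//; last exact: integrable_prod_integrand.
rewrite mxE [RHS]EFinM /Rintegral fineK//.
by apply: integrable_fin_num => //; exact: integrable_prod_integrand.
Qed.

End Gram.

End ProductSpace.

(** * Leave-one-out residuals *)

Lemma delta_comb (R : pzRingType) (n : nat) (j : 'I_n) (F : 'I_n -> R) :
  \sum_(l < n) (delta_mx j 0 : 'cV[R]_n) l 0 * F l = F j.
Proof.
rewrite (bigD1 j)//= mxE !eqxx mul1r big1 ?addr0// => l /negPf lj.
by rewrite mxE lj mul0r.
Qed.

Lemma quad_form_delta (R : comPzRingType) (n : nat) (M : 'M[R]_n) (j : 'I_n) :
  quad_form M (delta_mx j 0) = M j j.
Proof. by rewrite /quad_form trmx_delta -rowE -colE !mxE. Qed.

Lemma quad_form_deltaB (R : realType) (n : nat) (M : 'M[R]_n) (j k : 'I_n) :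
  M^T = M ->
  quad_form M (delta_mx j 0 - delta_mx k 0) = M j j + M k k - M j k *+ 2.
Proof.
move=> symM; rewrite quad_formD// !quad_form_delta.
have -> : quad_form M (- delta_mx k 0) = M k k.
  by rewrite -scaleN1r quad_formZ sqrrN expr1n mul1r quad_form_delta.
rewrite [(- delta_mx k 0)^T]linearN/= !mulNmx trmx_delta -rowE -colE 3!mxE.
have -> : M k j = M j k by rewrite -[in LHS]symM mxE.
by ring.
Qed.

(** The terms [B j j] and [B k k] are constant in [k], respectively [j], so their
    contribution is a multiple of the sum of the entries of [c]. *)
Lemma quad_form_semivariogram (R : realType) (n : nat) (B M : 'M[R]_n)
    (c : 'cV[R]_n) :
  (forall j k, M j k = (B j j + B k k) / 2 - B j k) ->
  \sum_(j < n) c j 0 = 0 ->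
  quad_form M c = - quad_form B c.
Proof.
move=> MB c0; rewrite !quad_formE.
pose b j := B j j / 2.
have split_sum j k : c j 0 * c k 0 * M j k =
    c j 0 * b j * c k 0 + c j 0 * (c k 0 * b k) - c j 0 * c k 0 * B j k.
  by rewrite MB /b; field.
under eq_bigr => j _ do under eq_bigr => k _ do rewrite split_sum.
under eq_bigr => j _ do
  rewrite sumrB big_split/= -!mulr_sumr c0 mulr0 add0r.
by rewrite sumrB -mulr_suml c0 mul0r sub0r.
Qed.

(** The coefficients of Q(x_i) - sum_k lam_k Q(x_(lift i k)) in the whole family
    of the Q(x_j). *)
Definition residual (R : realType) (n : nat) (i : 'I_n) (lam : 'cV[R]_n.-1) :
    'cV[R]_n :=
  \col_(j < n) oapp (fun k => - lam k 0) 1 (unlift i j).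

Section Residual.
Context (R : realType) (n : nat) (i : 'I_n).
Implicit Types lam : 'cV[R]_n.-1.

Lemma residual_self lam : residual i lam i 0 = 1.
Proof. by rewrite mxE unlift_none. Qed.

Lemma residual_lift lam k : residual i lam (lift i k) 0 = - lam k 0.
Proof. by rewrite mxE liftK. Qed.

Lemma residual_comb lam (F : 'I_n -> R) :
  \sum_(j < n) residual i lam j 0 * F j =
  F i - \sum_(k < n.-1) lam k 0 * F (lift i k).
Proof.
rewrite (@bigD1_ord _ _ _ _ i)//= residual_self mul1r -sumrN; congr (_ + _).
by apply: eq_bigr => k _; rewrite residual_lift mulNr.
Qed.

Lemma residual_sum lam :
  \sum_(j < n) residual i lam j 0 = 1 - \sum_(k < n.-1) lam k 0.
Proof.
have := residual_comb lam (fun=> 1).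
by under eq_bigr do rewrite mulr1; under [in X in _ = X]eq_bigr do rewrite mulr1.
Qed.

Lemma residual_inj : injective (residual i : 'cV[R]_n.-1 -> 'cV[R]_n).
Proof.
move=> lam lam' /colP e; apply/colP => k.
by have := e (lift i k); rewrite !residual_lift => /oppr_inj.
Qed.

Lemma residualP (c : 'cV[R]_n) : c i 0 = 1 -> exists lam, residual i lam = c.
Proof.
move=> ci; exists (\col_k - c (lift i k) 0).
apply/colP => j; case: (unliftP i j) => [k|] ->.
  by rewrite residual_lift mxE opprK.
by rewrite residual_self.
Qed.

End Residual.

(** * The leave-one-out formula *)

Theorem proposition4p1 (R : realType) (d n : nat) (n_ge2 : (2 <= n)%N)
    (N : 'rV[R]_d -> R) (N_norm : is_norm N) (D : set 'rV[R]_d)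
    (x : 'I_n -> 'rV[R]_d) (x_in_D : forall i, D (x i))
    (mu : 'I_n -> probability (measurableTypeR R) R)
    (mu_P2 : forall i, finite_second_moment (mu i))
    (dT : measure_display) (T : measurableType dT) (P : probability T R)
    (Q : 'rV[R]_d -> T -> R -> R) (gamma : R -> R)
    (Q_process : quantile_process P D Q)
    (Q_stat : isotropic_stationary P D N Q gamma)
    (Q_realization : exists w : T, forall (i : 'I_n) (xi : R), 0 < xi < 1 ->
       quantile (mu i) xi = Q (x i) w xi)
    (Gamma_inv : semivariogram_matrix N gamma x \in unitmx)
    (ones_neq0 : ones_form (semivariogram_matrix N gamma x) != 0)
    (diag_neq0 : forall i : 'I_n,
       Gamma_tilde (semivariogram_matrix N gamma x) i i != 0) :
  forall i : 'I_n,
    exists lam : 'cV[R]_n.-1,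
      kriging_argmin P Q (leave_out i x) (x i) = [set lam] /\
      forall xi : R, 0 < xi < 1 ->
        quantile (mu i) xi
          - kriging_prediction lam (leave_out i (fun j => quantile (mu j))) xi
        = \sum_(j < n)
            Gamma_tilde (semivariogram_matrix N gamma x) i j
            / Gamma_tilde (semivariogram_matrix N gamma x) i i
            * quantile (mu j) xi.
Proof.
move=> i.
set G := semivariogram_matrix N gamma x in Gamma_inv ones_neq0 diag_neq0 *.
pose f j := Q (x j).
have mf j : measurable_fun setT (on_cylinder (f j)).
  by have [qQ mQ _] := Q_process _ (x_in_D j); exact: measurable_on_cylinder.
have f_fin j : (mean_sq_L2 P (f j) < +oo)%E.
  by have [] := Q_process _ (x_in_D j).
pose B := gram P f.
have B_sym : B^T = B by exact: gram_sym.
have B_ge0 c : 0 <= quad_form B c.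
  rewrite -lee_fin -mean_sq_L2_comb//; apply: integral_ge0 => w _.
  by apply: integral_ge0 => xi _; rewrite lee_fin sqr_ge0.
(* Expand the square [(Q (x j) - Q (x k)) ^ 2]: the increment is the combination
   with coefficients [delta_j - delta_k]. *)
have GB j k : G j k = (B j j + B k k) / 2 - B j k.
  apply: EFin_inj; rewrite mxE -(Q_stat.1 _ _ (x_in_D j) (x_in_D k)).
  rewrite /semivariogram.
  have -> : (fun w xi => Q (x j) w xi - Q (x k) w xi) = (fun w xi =>
      \sum_(l < n) (delta_mx j 0 - delta_mx k 0 : 'cV[R]_n) l 0 * f l w xi).
    apply/funext => w; apply/funext => xi.
    under eq_bigr => l _ do rewrite mxE [X in _ + X]mxE mulrBl.
    by rewrite sumrB !delta_comb.
  rewrite mean_sq_L2_comb// quad_form_deltaB ?gram_sym// -EFinM.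
  by congr (_%:E); rewrite -/B; field.
have G_sym : G^T = G.
  apply/matrixP => j k; rewrite mxE !GB [B j j + _]addrC; congr (_ - _).
  by rewrite -[in LHS]B_sym mxE.
have G_le0 v : (ones R n)^T *m v = 0 -> quad_form G v <= 0.
  move=> /ones_tr_eq0 v0.
  by rewrite (quad_form_semivariogram GB v0) oppr_le0.
have errorE (lam : 'cV[R]_n.-1) : \sum_(k < n.-1) lam k 0 = 1 ->
    kriging_error P Q (leave_out i x) (x i) lam =
    (- quad_form G (residual i lam))%:E.
  move=> lam1; rewrite (quad_form_semivariogram GB); last first.
    by rewrite residual_sum lam1 subrr.
  rewrite opprK -mean_sq_L2_comb//; congr mean_sq_L2.
  by apply/funext => w; apply/funext => xi; rewrite residual_comb.
have [lam0 lam0E] := residualP (residual_col_self (diag_neq0 i)).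
have res_sum (lam : 'cV[R]_n.-1) : \sum_(k < n.-1) lam k 0 = 1 ->
    (ones R n)^T *m residual i lam = 0.
  by move=> lam1; apply/ones_tr_eq0; rewrite residual_sum lam1 subrr.
have lam0_sum : \sum_(k < n.-1) lam0 k 0 = 1.
  have /ones_tr_eq0 := ones_residual_col ones_neq0 i.
  by rewrite -lam0E residual_sum => /eqP; rewrite subr_eq0 => /eqP.
exists lam0; split.
  apply/seteqP; split=> [lam [lam1 lam_min]|_ ->].
    apply: (@residual_inj _ _ i); rewrite lam0E.
    apply: residual_col_unique => //; [exact: res_sum|exact: residual_self|].
    have := lam_min _ lam0_sum.
    by rewrite !errorE// lee_fin lerN2 lam0E.
  split=> // lam lam1; rewrite !errorE// lee_fin lerN2 lam0E.
  by apply: residual_col_max => //; [exact: res_sum|exact: residual_self].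
move=> xi _; rewrite /kriging_prediction /leave_out.
rewrite -(residual_comb i lam0 (fun j => quantile (mu j) xi)) lam0E.
apply: eq_bigr => j _; congr (_ * _).
rewrite [LHS]mxE [col i _ j 0]mxE mulrC; congr (_ / _).
by rewrite -[in LHS](Gamma_tilde_sym G_sym) mxE.
Qed.
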